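(* Suppose a Banach space $\mathcal{Y}$ is such that there exist $\gamma>0$ and $\sigma\in[0,1/2)$ so that, for infinitely many positive integers $n$, there exist bounded linear operators $A_n:\ell_2^n\to\mathcal{Y}$ and $B_n:\mathcal{Y}\to\ell_2^n$ with $B_nA_n=I_{\ell_2^n}$ and $\|A_n\|\,\|B_n\|\le\gamma n^{\sigma}$. Then $\mathcal{Y}$ contains a compact subset $K$ such that $$\limsup_{n\to\infty}\frac{d_n(K,\mathcal{Y})}{d_n^a(K)}=\infty .$$
   Context: For a subset $K$ of a Banach space $\mathcal{X}$ and an integer $n\ge 0$, the Kolmogorov $n$-width is $d_n(K,\mathcal{X})=\inf_{\mathcal{X}_n}\sup_{x\in K}\inf_{z\in\mathcal{X}_n}\|x-z\|$, the outer infimum being over all linear subspaces $\mathcal{X}_n\subset\mathcal{X}$ of dimension at most $n$. For a compact $K$ in a Banach space $\mathcal{Y}$, the $n$-th absolute width is $d_n^a(K)=\inf_{\mathcal{Z}}d_n(K,\mathcal{Z})$, the infimum being over all Banach spaces $\mathcal{Z}$ containing $\mathcal{Y}$ isometrically as a subspace. *)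

(* Defs.v *)
From HB Require Import structures.
From mathcomp Require Import all_boot all_order all_algebra.
From mathcomp Require Import all_classical all_reals all_analysis.
From mathcomp Require Import ring lra.

Set Implicit Arguments.
Unset Strict Implicit.
Unset Printing Implicit Defensive.

Import Order.TTheory GRing.Theory Num.Theory.
Import numFieldNormedType.Exports.

Local Open Scope classical_set_scope.
Local Open Scope ring_scope.

(* An alias of 'rV[R]_n is needed because row vectors canonically carry the
   max norm. *)
Definition l2 (R : realType) (n : nat) : Type := 'rV[R]_n.

HB.instance Definition _ (R : realType) (n : nat) :=
  GRing.Lmodule.copy (l2 R n) 'rV[R]_n.

Definition l2norm (R : realType) (n : nat) (x : l2 R n) : R :=
  Num.sqrt (\sum_(i < n) (x : 'rV[R]_n) ord0 i ^+ 2).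

Section L2Norm.
Context {R : realType} {n : nat}.
Implicit Types x y : l2 R n.

Let coord x i : R := (x : 'rV[R]_n) ord0 i.

Lemma l2norm_ge0 x : 0 <= l2norm x.
Proof. exact: sqrtr_ge0. Qed.

Lemma l2norm_sqr x : l2norm x ^+ 2 = \sum_(i < n) coord x i ^+ 2.
Proof. by rewrite sqr_sqrtr// sumr_ge0// => i _; exact: sqr_ge0. Qed.

Lemma l2norm0_eq0 x : l2norm x = 0 -> x = 0.
Proof.
move=> x0; apply/rowP => i; rewrite mxE; apply/eqP; rewrite -sqrf_eq0.
have /eqP := l2norm_sqr x.
rewrite x0 expr0n/= eq_sym psumr_eq0 => [|j _]; last exact: sqr_ge0.
by move=> /allP/(_ i); rewrite mem_index_enum => /(_ isT).
Qed.

Lemma l2normZ (l : R) x : l2norm (l *: x) = `|l| * l2norm x.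
Proof.
rewrite /l2norm -sqrtr_sqr -sqrtrM ?sqr_ge0// mulr_sumr.
by congr Num.sqrt; apply: eq_bigr => i _; rewrite mxE exprMn.
Qed.

Lemma l2_dot_le x y :
  \sum_(i < n) coord x i * coord y i <= l2norm x * l2norm y.
Proof.
have [x0|xN0] := eqVneq (l2norm x) 0.
  rewrite x0 mul0r big1// => i _.
  by rewrite (l2norm0_eq0 x0) /coord mxE mul0r.
have [y0|yN0] := eqVneq (l2norm y) 0.
  rewrite y0 mulr0 big1// => i _.
  by rewrite (l2norm0_eq0 y0) /coord mxE mulr0.
have p0 : 0 < l2norm x * l2norm y.
  by rewrite mulr_gt0// lt_neqAle eq_sym ?xN0 ?yN0 l2norm_ge0.
rewrite -(ler_pM2l p0).
have : 0 <= \sum_(i < n) (l2norm y * coord x i - l2norm x * coord y i) ^+ 2.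
  by rewrite sumr_ge0// => i _; exact: sqr_ge0.
under eq_bigr => i _.
  rewrite (_ : _ ^+ 2 = l2norm y ^+ 2 * coord x i ^+ 2
    + l2norm x ^+ 2 * coord y i ^+ 2
    + - 2 * (l2norm x * l2norm y) * (coord x i * coord y i)); last by ring.
  over.
rewrite !big_split/= -!mulr_sumr -!l2norm_sqr.
set S := \sum_(i < n) _; nra.
Qed.

Lemma ler_l2normD x y : l2norm (x + y) <= l2norm x + l2norm y.
Proof.
rewrite -(@ler_pXn2r _ 2)// ?nnegrE ?addr_ge0 ?l2norm_ge0//.
rewrite sqrrD !l2norm_sqr.
under eq_bigr => i _.
  rewrite /coord mxE -/(coord x i) -/(coord y i) sqrrD.
  over.
rewrite !big_split/= lerD2r lerD2l -mulr2n lerMn2r/=.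
exact: l2_dot_le.
Qed.

End L2Norm.

HB.instance Definition _ (R : realType) (n : nat) :=
  Lmodule_isNormed.Build R (l2 R n)
    (@ler_l2normD R n) (@l2normZ R n) (@l2norm0_eq0 R n).

Lemma l2normE (R : realType) (n : nat) (x : l2 R n) : `|x| = l2norm x.
Proof. by []. Qed.

Definition opnorm (R : realType) (U V : normedModType R)
    (f : {linear U -> V}) : \bar R :=
  ereal_sup [set (`|f x|)%:E | x in [set x : U | `|x| <= 1]].

Definition lin_indep (R : realType) (X : normedModType R) (k : nat)
    (e : 'I_k -> X) : Prop :=
  forall c : 'I_k -> R, \sum_(i < k) c i *: e i = 0 -> forall i, c i = 0.

Definition lin_span (R : realType) (X : normedModType R) (k : nat)
    (e : 'I_k -> X) : set X :=
  [set \sum_(i < k) c i *: e i | c in [set: 'I_k -> R]].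

Definition has_dim (R : realType) (X : normedModType R) (k : nat)
    (V : set X) : Prop :=
  exists2 e : 'I_k -> X, lin_indep e & V = lin_span e.

Definition subspace_dim_le (R : realType) (X : normedModType R) (n : nat)
    (V : set X) : Prop :=
  exists2 k, (k <= n)%N & has_dim k V.

(* For K empty this is -oo (the supremum of the empty set), so it is only
   meaningful for nonempty K. *)
Definition kolmogorov_width (R : realType) (X : normedModType R) (n : nat)
    (K : set X) : \bar R :=
  ereal_inf [set ereal_sup [set ereal_inf [set (`|x - z|)%:E | z in V]
                           | x in K]
            | V in [set V : set X | subspace_dim_le n V]].

Definition absolute_width (R : realType) (Y : completeNormedModType R)
    (n : nat) (K : set Y) : \bar R :=
  ereal_inf [set w | exists (Z : completeNormedModType R)
      (iota : {linear Y -> Z}),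
    (forall y, `|iota y| = `|y|) /\ w = kolmogorov_width n (iota @` K)].

(* Main.v *)
(** Take an orthonormal basis [e_1, .., e_n] of [l_2^n] and push it into [Y] by
    [A]. A subspace of dimension at most [n / 2] stays at distance of order 1 from
    some [e_i], so applying [B] shows that the [A e_i] have Kolmogorov width at least
    of order [1 / ||B||] in [Y]. Their absolute width is of order at most
    [||A|| (log n / n)^(1/2)]: by a union bound over the points produced by Maurey's
    empirical method, some [k x n] sign matrix [G] with [k = n / 4] satisfies
      [||x||_2 <= C (log n / n)^(1/2) ||x||_1 + (4 / k^(1/2)) ||G x||_2],
    and this estimate says exactly that enlarging [Y] by [R^k], with the
    points [(A e_i, - G e_i)] added (suitably scaled) to the unit ball, does not
    change the norm of [Y]; in the enlarged space the [A e_i] are close to [R^k].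
    The ratio of the widths is thus of order [n^(1/2 - sigma)] up to logarithms.
    Finally [K] is the union of [{0}] and of such systems with [n] growing and the
    norms decreasing so fast that later systems are negligible in earlier widths,
    while the earlier ones, being finite and of size at most [n / 4], are put inside
    the approximating subspace. *)

From HB Require Import structures.
Require Import Defs.
From mathcomp Require Import all_boot all_order all_algebra.
From mathcomp Require Import all_classical all_reals all_analysis.
From mathcomp Require Import ring lra.
Import Order.TTheory GRing.Theory Num.Theory.
Import numFieldNormedType.Exports.

Set Implicit Arguments.
Unset Strict Implicit.
Unset Printing Implicit Defensive.

Local Open Scope classical_set_scope.
Local Open Scope ring_scope.

(** * Sign matrices and Maurey sampling by averaging *)

Section Discretization.
Variable R : realType.

(** If [f] exceeded [c] everywhere, so would its mean under the probability distribution [p]: the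
    averaging step of the probabilistic method. *)
Lemma exists_le_weighted (I : finType) (p f : I -> R) (c : R) :
  (forall i, 0 <= p i) -> \sum_i p i = 1 -> \sum_i p i * f i <= c ->
  exists i, f i <= c.
Proof.
move=> p0 p1 pf; apply: contrapT => /forallNP fc.
have cf i : c < f i by rewrite ltNge; apply/negP/fc.
have le i : p i * c <= p i * f i by rewrite ler_wpM2l ?p0// ltW.
have : \sum_i p i * f i = c.
  apply/eqP; rewrite eq_le pf/= -[leLHS]mul1r -p1 mulr_suml.
  by apply: ler_sum => i _.
rewrite -[RHS]mul1r -p1 mulr_suml => /esym eqs.
have /eqP : \sum_i (p i * f i - p i * c) = 0 by rewrite sumrB eqs subrr.
rewrite psumr_eq0 => [|i _]; last by rewrite subr_ge0.
move=> /allP eq0; suff : \sum_i p i = 0 by rewrite p1 => /eqP; rewrite oner_eq0.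
apply: big1 => i _; have := eq0 i; rewrite mem_index_enum => /(_ isT).
rewrite /= -mulrBr mulf_eq0 => /orP[/eqP//|].
by rewrite subr_eq0 gt_eqF.
Qed.

(* The bound is the expectation over independent signs, with the fourth
   moment replaced by its upper bound; the signs are chosen one at a time. *)
Lemma exists_signs_shifted (I : finType) (P : pred I) (w t : I -> R) (n : nat)
    (a : I -> R) (y : I -> 'I_n -> R) :
  (forall i, 0 <= w i) ->
  exists g : 'I_n -> R, (forall j, g j ^+ 2 = 1) /\
    \sum_(i | P i) w i * (1 - t i * (a i + \sum_j g j * y i j) ^+ 2
                  + t i ^+ 2 * (a i + \sum_j g j * y i j) ^+ 4)
    <= \sum_(i | P i) w i * (1 - t i * (a i ^+ 2 + \sum_j y i j ^+ 2)
                  + t i ^+ 2 * (a i ^+ 4 + 6 * a i ^+ 2 * (\sum_j y i j ^+ 2)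
                     + 3 * (\sum_j y i j ^+ 2) ^+ 2)).
Proof.
move=> w0; elim: n a y => [|n IH] a y.
  exists (fun=> 1); split=> [j|]; first by rewrite expr1n.
  by apply: ler_sum => i _; rewrite !big_ord0; apply: ler_wpM2l => //; lra.
pose q i := \sum_(j < n) y i (lift ord0 j) ^+ 2.
pose Phi (s : R) := \sum_(i | P i) w i *
  (1 - t i * ((a i + s * y i ord0) ^+ 2 + q i)
   + t i ^+ 2 * ((a i + s * y i ord0) ^+ 4 + 6 * (a i + s * y i ord0) ^+ 2 * q i
       + 3 * q i ^+ 2)).
set bound := (leRHS in exists g, _ /\ _ <= leRHS).
have [s s1 sP] : exists2 s : R, s ^+ 2 = 1 & Phi s <= bound.
  (* One of the two signs is at least as good as their mean. The slack 4 (t b^2)^2 below comes from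
     bounding the fourth moment b^4 of the new term by 3 b^4. *)
  have : Phi 1 + Phi (-1) <= bound *+ 2.
    rewrite /Phi /bound -sumrMnl -big_split/=; apply: ler_sum => i _.
    rewrite big_ord_recl -/(q i) -mulrDr -mulrnAr; apply: ler_wpM2l => //.
    set b := y i ord0; rewrite -subr_ge0.
    rewrite [leRHS](_ : _ = 4 * (t i * b ^+ 2) ^+ 2); last by ring.
    by rewrite mulr_ge0// sqr_ge0.
  have [le1|gt1] := leP (Phi 1) bound; first by exists 1; rewrite ?expr1n.
  by move=> le2; exists (-1); rewrite ?sqrrN ?expr1n//; lra.
have [g [g1 gP]] := IH (fun i => a i + s * y i ord0) (fun i j => y i (lift ord0 j)).
exists (fun j => oapp g s (unlift ord0 j)); split=> [j|].
  by case: unliftP => [k|] _ /=.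
apply: le_trans sP; apply: le_trans gP.
rewrite le_eqVlt; apply/orP; left; apply/eqP; apply: eq_bigr => i _.
rewrite big_ord_recl unlift_none/= addrA.
by under eq_bigr do rewrite liftK/=.
Qed.

(** A point on which all rows are small has a product close to 1, so a small sum leaves no such
    point. Each row gains 11/12: with u = t s^2 and t = 1/(6 q), 1/(1 + u) <= 1 - u + u^2, whose
    mean is at most 1 - 1/6 + 3/36. *)
Lemma exists_sign_rows (I : finType) (P : pred I) (n k : nat)
    (y : I -> 'I_n -> R) :
  (forall i, P i -> 0 < \sum_j y i j ^+ 2) ->
  exists G : 'I_k -> 'I_n -> R, (forall r j, G r j ^+ 2 = 1) /\
    \sum_(i | P i) \prod_r
      (1 + (6 * \sum_j y i j ^+ 2)^-1 * (\sum_j G r j * y i j) ^+ 2)^-1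
    <= (11 / 12) ^+ k * \sum_(i | P i) 1.
Proof.
move=> q0; elim: k => [|k [G [G1 GP]]].
  exists (fun _ _ => 1); split=> [[]//|].
  by rewrite mul1r; apply: ler_sum => i _; rewrite big_ord0.
pose q i := \sum_j y i j ^+ 2.
pose t i : R := (6 * q i)^-1.
pose W i := \prod_r (1 + t i * (\sum_j G r j * y i j) ^+ 2)^-1.
have t0 i : 0 <= t i.
  by rewrite invr_ge0 mulr_ge0// sumr_ge0// => j _; rewrite sqr_ge0.
have W0 i : 0 <= W i.
  by rewrite prodr_ge0// => r _; rewrite invr_ge0 addr_ge0// mulr_ge0 ?sqr_ge0.
(* Each point is weighted by its product over the rows already chosen. *)
have [g [g1 gP]] := exists_signs_shifted P t (fun=> 0) y W0.
exists (fun r => oapp G g (unlift ord0 r)); split=> [r j|].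
  by case: unliftP => [r'|] _ /=.
rewrite (eq_bigr (fun i => (1 + t i * (\sum_j g j * y i j) ^+ 2)^-1 * W i)); last first.
  move=> i _; rewrite big_ord_recl unlift_none/=; congr (_ * _).
  by apply: eq_bigr => r _; rewrite liftK.
rewrite exprS -mulrA; apply: le_trans (ler_wpM2l _ GP); last by lra.
rewrite mulr_sumr; apply: (@le_trans _ _ (\sum_(i | P i) W i *
    (1 - t i * (0 + \sum_j g j * y i j) ^+ 2
     + t i ^+ 2 * (0 + \sum_j g j * y i j) ^+ 4))).
  apply: ler_sum => i _; rewrite mulrC -/(q i) -/(t i) -/(W i) add0r.
  apply: ler_wpM2l => //; set s := \sum_j _.
  have u0 : 0 <= t i * s ^+ 2 by rewrite mulr_ge0 ?sqr_ge0.
  rewrite -div1r ler_pdivrMr ?ltr_pwDl// -subr_ge0.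
  rewrite [leRHS](_ : _ = (t i * s ^+ 2) ^+ 3); last by ring.
  by rewrite exprn_ge0.
apply: (le_trans gP); apply: ler_sum => i Pi.
rewrite -/(q i) -/(t i) -/(W i) mulrC; apply: ler_wpM2r => //.
have tq : t i * q i = 6^-1.
  by rewrite /t invfM -mulrA mulVf ?mulr1// gt_eqF// q0.
rewrite !expr0n/= mulr0 mul0r !add0r tq mulrCA -exprMn tq.
lra.
Qed.


(** Union bound: each product in [exists_sign_rows] is at most the whole sum, hence below (23/24)^k,
    as 11/12 times 23/22 is 23/24. Inverting and applying AM-GM, the mean over the rows of s^2 / (6
    q) is at least 1/23. *)
Lemma exists_sign_matrix (I : finType) (n k : nat) (y : I -> 'I_n -> R) :
  #|I|%:R < (23 / 22 : R) ^+ k ->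
  exists G : 'I_k -> 'I_n -> R, (forall r j, G r j ^+ 2 = 1) /\
    forall i, 6 / 23 * k%:R * \sum_j y i j ^+ 2
              <= \sum_r (\sum_j G r j * y i j) ^+ 2.
Proof.
move=> cardI; pose q i := \sum_j y i j ^+ 2.
have q_ge0 i : 0 <= q i by rewrite sumr_ge0// => j _; rewrite sqr_ge0.
have [|G [G1 GP]] := @exists_sign_rows I (fun i => q i != 0) n k y.
  by move=> i; rewrite lt_neqAle eq_sym => ->/=; exact: q_ge0.
exists G; split=> // i; rewrite -/(q i).
have [->|qi0] := eqVneq (q i) 0.
  by rewrite mulr0 sumr_ge0// => r _; rewrite sqr_ge0.
have qi_gt0 : 0 < q i by rewrite lt_neqAle eq_sym qi0 q_ge0.
have [k0|k_gt0] := posnP k.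
  by rewrite {1}k0 mulr0 mul0r sumr_ge0// => r _; rewrite sqr_ge0.
have kR0 : 0 < k%:R :> R by rewrite ltr0n.
pose t i : R := (6 * q i)^-1.
pose s i r := \sum_j G r j * y i j.
have t_ge0 l : 0 <= t l by rewrite invr_ge0 mulr_ge0.
have u_gt0 l r : 0 < 1 + t l * s l r ^+ 2.
  by rewrite ltr_pwDl// mulr_ge0 ?sqr_ge0.
have prod_gt : (24 / 23) ^+ k < \prod_r (1 + t i * s i r ^+ 2).
  have : \prod_r (1 + t i * s i r ^+ 2)^-1 < (23 / 24) ^+ k.
    apply: (@le_lt_trans _ _ ((11 / 12) ^+ k * \sum_(l | q l != 0) 1)).
      apply: le_trans GP; rewrite [leRHS](bigD1 i)//= lerDl.
      apply: sumr_ge0 => l _; apply: prodr_ge0 => r _.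
      by rewrite invr_ge0; apply: ltW; apply: u_gt0.
    apply: (@le_lt_trans _ _ ((11 / 12) ^+ k * #|I|%:R)).
      rewrite ler_wpM2l ?exprn_ge0 ?divr_ge0//.
      by rewrite (sumr_const [pred l | q l != 0]) ler_nat max_card.
    have -> : 23 / 24 = (11 / 12) * (23 / 22) :> R by field.
    by rewrite [ltRHS]exprMn ltr_pM2l// exprn_gt0// divr_gt0.
  rewrite prodfV -[X in _ < X -> _]invrK.
  rewrite ltf_pV2 ?posrE ?invr_gt0 ?exprn_gt0 ?divr_gt0//; last exact: prodr_gt0.
  by rewrite -exprVn invf_div.
have AGM : \prod_r (1 + t i * s i r ^+ 2)
    <= ((\sum_r (1 + t i * s i r ^+ 2)) / k%:R) ^+ k.
  have := @leif_AGM R 'I_k predT (fun r => 1 + t i * s i r ^+ 2).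
  rewrite /= cardT size_enum_ord => H.
  by apply: H => r _; exact: ltW.
have := lt_le_trans prod_gt AGM.
rewrite ltr_pXn2r ?nnegrE ?divr_ge0//; last first.
  by apply: sumr_ge0 => r _; exact: ltW.
rewrite ltr_pdivlMr// big_split/= sumr_const card_ord -mulr_sumr => lt.
have {lt} : 23^-1 * k%:R <= t i * \sum_r s i r ^+ 2 by lra.
rewrite /t ler_pdivlMl ?mulr_gt0//.
by have -> : 6 * q i * (23^-1 * k%:R) = 6 / 23 * k%:R * q i by field.
Qed.

(* Maurey's empirical method, derandomized: each new atom increases the
   squared error by at most its mean increase. *)
Lemma empirical_approximation (I L : finType) (p : I -> R) (m : L -> R)
    (v : I -> L -> R) (c : R) (N : nat) :
  (forall i, 0 <= p i) -> \sum_i p i = 1 -> (forall l, 0 <= m l) ->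
  (forall i, \sum_l m l * v i l ^+ 2 <= c) ->
  exists f : 'I_N -> I,
    \sum_l m l * (\sum_j v (f j) l - N%:R * \sum_i p i * v i l) ^+ 2 <= N%:R * c.
Proof.
move=> p0 p1 m0 vc; elim: N => [|N [f fP]].
  have f0 : 'I_0 -> I by case.
  exists f0; rewrite mul0r big1// => l _; rewrite big_ord0 mul0r subrr expr0n/= mulr0//.
pose b l := \sum_i p i * v i l.
pose D l := \sum_j v (f j) l - N%:R * b l.
have [i iP] : exists i, \sum_l m l * (D l + (v i l - b l)) ^+ 2 <= N.+1%:R * c.
  apply: (exists_le_weighted p0 p1).
  under eq_bigr do rewrite mulr_sumr.
  rewrite exchange_big/=.
  (* The mean of (D + v - b)^2 is D^2 plus the variance of v, which is at most its second moment. *)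
  apply: (@le_trans _ _ (\sum_l m l * (D l ^+ 2 + \sum_i p i * v i l ^+ 2))).
    apply: ler_sum => l _; under eq_bigr do rewrite mulrCA.
    rewrite -mulr_sumr; apply: ler_wpM2l => //.
    rewrite (eq_bigr (fun i => (D l - b l) ^+ 2 * p i +
      2 * (D l - b l) * (p i * v i l) + p i * v i l ^+ 2)); last by move=> *; ring.
    rewrite !big_split/= -!mulr_sumr p1 -/(b l); nra.
  under eq_bigr do rewrite mulrDr.
  rewrite big_split/= -natr1 mulrDl mul1r lerD//.
  under eq_bigr do rewrite mulr_sumr.
  rewrite exchange_big/= -[leRHS]mul1r -p1 mulr_suml; apply: ler_sum => i _.
  by under eq_bigr do rewrite mulrCA; rewrite -mulr_sumr ler_wpM2l.
exists (fun j => oapp f i (unlift ord0 j)); apply: le_trans iP.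
rewrite le_eqVlt; apply/orP; left; apply/eqP; apply: eq_bigr => l _.
congr (_ * _ ^+ 2); rewrite big_ord_recl unlift_none/=.
under eq_bigr do rewrite liftK/=.
rewrite /D /b -natr1; ring.
Qed.

End Discretization.

(** * Gelfand widths: the l2 norm bounded by the l1 norm and few measurements *)

Section GelfandWidth.
Variable R : realType.

(** Maurey's method replaces N x by a sum of N signed unit vectors. These sums come from (2n)^N
    sequences, few enough for one [G] to be bounded below on all of them, and the sampling error is
    controlled for x and for G x at once. *)
Lemma exists_l2_le_l1_matrix_normalized (n k N : nat) :
  (0 < k)%N -> (0 < N)%N -> ((n * 2) ^ N)%:R < (23 / 22 : R) ^+ k ->
  exists G : 'I_k -> 'I_n -> R, forall (x : 'I_n -> R) (B : R),
    \sum_j `|x j| = 1 -> (forall r, `|\sum_j G r j * x j| <= B) ->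
    \sum_j x j ^+ 2 <= 36 / N%:R + 16 * B ^+ 2.
Proof.
move=> k0 N0 nNk.
have kR0 : 0 < k%:R :> R by rewrite ltr0n.
have NR0 : 0 < N%:R :> R by rewrite ltr0n.
pose y (t : {ffun 'I_N -> 'I_n * bool}) (j : 'I_n) : R :=
  \sum_J (-1) ^+ (t J).2 * ((t J).1 == j)%:R.
have [|G [G1 GP]] := @exists_sign_matrix R {ffun 'I_N -> 'I_n * bool} n k y.
  by rewrite card_ffun card_prod card_bool !card_ord.
exists G => x B x1 GB.
pose u r := \sum_j G r j * x j.
pose sg i : R := (-1) ^+ (x i < 0)%R.
have sgx i : `|x i| * sg i = x i.
  by rewrite /sg mulrC -realEsign ?num_real.
(* The weight [k] on the l2 error balances the [k] measurements: each atom has second moment k + k =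
   2 k. *)
pose m (l : 'I_n + 'I_k) : R := if l is inl _ then k%:R else 1.
pose v i (l : 'I_n + 'I_k) : R :=
  match l with inl j => sg i * (i == j)%:R | inr r => G r i * sg i end.
have [|i|f] := @empirical_approximation R 'I_n ('I_n + 'I_k)%type
    (fun i => `|x i|) m v (2 * k%:R) N (fun i => normr_ge0 _) x1.
- by case=> // _; exact: ltW.
- rewrite big_sumType/= -mulr_sumr (bigD1 i)//= eqxx big1 => [|j ji]; last first.
    by rewrite eq_sym (negbTE ji) mulr0 expr0n.
  rewrite mulr1 addr0 sqrr_sign mulr1.
  under eq_bigr do rewrite mul1r exprMn sqrr_sign mulr1 G1.
  by rewrite sumr_const card_ord; lra.
pose T : {ffun 'I_N -> 'I_n * bool} := [ffun J => (f J, x (f J) < 0)].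
have vl1 j : \sum_J v (f J) (inl j) = y T j by apply: eq_bigr => J _; rewrite ffunE.
have vl2 j : \sum_i `|x i| * v i (inl j) = x j.
  rewrite (bigD1 j)//= eqxx mulr1 sgx big1 ?addr0// => i ij.
  by rewrite (negbTE ij) !mulr0.
have vr1 r : \sum_J v (f J) (inr r) = \sum_j G r j * y T j.
  rewrite /y; under [RHS]eq_bigr do rewrite mulr_sumr.
  rewrite exchange_big/=; apply: eq_bigr => J _.
  rewrite (bigD1 (f J))//= ffunE/= eqxx mulr1 big1 ?addr0// => j jf.
  by rewrite eq_sym (negbTE jf) !mulr0.
have vr2 r : \sum_i `|x i| * v i (inr r) = u r.
  by apply: eq_bigr => i _; rewrite /= mulrCA sgx.
have -> : \sum_l m l * (\sum_J v (f J) l - N%:R * \sum_i `|x i| * v i l) ^+ 2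
   = k%:R * \sum_j (y T j - N%:R * x j) ^+ 2
     + \sum_r ((\sum_j G r j * y T j) - N%:R * u r) ^+ 2.
  rewrite big_sumType/= mulr_sumr; congr (_ + _); apply: eq_bigr => l _.
    by rewrite vl1 vl2.
  by rewrite vr1 vr2 mul1r.
have uB r : `|u r| <= B := GB r.
have := GP T.
move: (y T) u uB {vl1 vl2 vr1 vr2} => z u uB.
set Y := \sum_j z j ^+ 2; set Z := \sum_r _ => YZ.
set Q1 := \sum_j (_ - _) ^+ 2; set Q2 := \sum_r (_ - _) ^+ 2 => Q12.
have Q20 : 0 <= Q2 by rewrite sumr_ge0// => r _; rewrite sqr_ge0.
have Q10 : 0 <= Q1 by rewrite sumr_ge0// => r _; rewrite sqr_ge0.
have ZQ : Z <= 2 * Q2 + 2 * N%:R ^+ 2 * (k%:R * B ^+ 2).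
  have -> : k%:R * B ^+ 2 = \sum_(r < k) B ^+ 2.
    by rewrite sumr_const card_ord mulr_natl.
  rewrite !mulr_sumr -big_split/=; apply: ler_sum => r _.
  have : u r ^+ 2 <= B ^+ 2.
    rewrite -[u r ^+ 2]real_normK ?num_real// lerXn2r ?nnegrE//.
    exact: le_trans (uB r).
  set g := \sum_j _; move: (sqr_ge0 (g - 2 * (N%:R * u r))) => h1 h2.
  rewrite -subr_ge0; have h3 : 0 <= N%:R ^+ 2 * (B ^+ 2 - u r ^+ 2).
    by rewrite mulr_ge0 ?sqr_ge0 ?subr_ge0.
  nra.
pose X := \sum_j x j ^+ 2.
have XY : N%:R ^+ 2 * X <= 2 * Y + 2 * Q1.
  rewrite !mulr_sumr -big_split/=; apply: ler_sum => j _.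
  have := sqr_ge0 (2 * z j - N%:R * x j); nra.
(* From k Y <= (23/6) Z and k Q1 + Q2 <= 2 k N the constants come out as 92/3 and 46/3, rounded up
   to the squares 36 and 16. *)
have XN : k%:R * (N%:R ^+ 2 * X) <= k%:R * (36 * N%:R + 16 * N%:R ^+ 2 * B ^+ 2).
  have : 0 <= k%:R * (N%:R ^+ 2 * B ^+ 2) :> R.
    by rewrite mulr_ge0 ?(ltW kR0)// mulr_ge0 ?sqr_ge0.
  have : 0 <= k%:R * N%:R :> R by rewrite mulr_ge0 ?(ltW kR0) ?(ltW NR0).
  have : 0 <= k%:R * Q1 by rewrite mulr_ge0 ?(ltW kR0) ?(ltW NR0).
  have : k%:R * (N%:R ^+ 2 * X) <= k%:R * (2 * Y + 2 * Q1) by rewrite ler_pM2l.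
  nra.
rewrite ler_pM2l// in XN.
rewrite -(@ler_pM2l _ (N%:R ^+ 2)) ?exprn_gt0//.
apply: (le_trans XN); rewrite le_eqVlt; apply/orP; left; apply/eqP.
by field; rewrite gt_eqF.
Qed.

(** Normalize x in l1 and use sqrt(a^2 + b^2) <= a + b. The measurements enter through their
    maximum, to match the max norm of ['rV[R]_k]. *)
Lemma exists_l2_le_l1_matrix (n k N : nat) :
  (0 < k)%N -> (0 < N)%N -> ((n * 2) ^ N)%:R < (23 / 22 : R) ^+ k ->
  exists G : 'I_k -> 'I_n -> R, forall (x : 'I_n -> R) (B : R),
    (forall r, `|\sum_j G r j * x j| <= B) ->
    Num.sqrt (\sum_j x j ^+ 2) <= 6 / Num.sqrt N%:R * (\sum_j `|x j|) + 4 * B.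
Proof.
move=> k0 N0 /(exists_l2_le_l1_matrix_normalized k0 N0)[G GP].
have NR0 : 0 < N%:R :> R by rewrite ltr0n.
exists G => x B GB; pose s := \sum_j `|x j|.
have B0 : 0 <= B by apply: le_trans (GB (Ordinal k0)).
have s0 : 0 <= s by rewrite sumr_ge0.
have [s_eq0|s_neq0] := eqVneq s 0.
  have -> : \sum_j x j ^+ 2 = 0.
    apply: big1 => j _; move/eqP: s_eq0; rewrite psumr_eq0//.
    by move=> /allP/(_ j); rewrite mem_index_enum normr_eq0 => /(_ isT)/eqP->; rewrite expr0n.
  by rewrite sqrtr0 addr_ge0 ?mulr_ge0 ?invr_ge0 ?sqrtr_ge0.
have s_gt0 : 0 < s by rewrite lt_neqAle eq_sym s_neq0.
have xs1 : \sum_j `|x j / s| = 1.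
  transitivity (s / s); last exact: divff.
  rewrite {2}/s mulr_suml; apply: eq_bigr => j _.
  by rewrite normrM [X in _ * X]ger0_norm// invr_ge0.
have GBs r : `|\sum_j G r j * (x j / s)| <= B / s.
  under eq_bigr do rewrite mulrA.
  by rewrite -mulr_suml normrM [X in _ * X]ger0_norm ?invr_ge0// ler_wpM2r ?invr_ge0.
have := GP _ _ xs1 GBs.
under eq_bigr do rewrite exprMn.
rewrite -mulr_suml exprVn ler_pdivrMr ?exprn_gt0// => le1.
have h0 : 0 <= 6 / Num.sqrt N%:R * s by rewrite !mulr_ge0 ?invr_ge0 ?sqrtr_ge0.
rewrite -(@ler_pXn2r _ 2)// ?nnegrE ?sqrtr_ge0 ?addr_ge0 ?mulr_ge0//.
rewrite sqr_sqrtr; last by rewrite sumr_ge0// => j _; rewrite sqr_ge0.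
apply: (le_trans le1).
have -> : (36 / N%:R + 16 * (B / s) ^+ 2) * s ^+ 2
    = (6 / Num.sqrt N%:R * s) ^+ 2 + (4 * B) ^+ 2.
  have {1}-> : N%:R = Num.sqrt N%:R ^+ 2 :> R by rewrite sqr_sqrtr ?ltW.
  by field; rewrite s_neq0 gt_eqF ?sqrtr_gt0.
by rewrite -/s sqrrD lerD2r lerDl mulrn_wge0// mulr_ge0 ?mulr_ge0.
Qed.

End GelfandWidth.

(** * Amalgams: enlarging [Y] by [W] without changing its norm *)

(** [amalgA_le] is what preserves the norm of [Y]; [amalgB_le] keeps the lowered norm equivalent to
    the product norm, hence definite and complete. *)
Record amalgam_data (R : realType) (Y W : completeNormedModType R)
    (E : lmodType R) := AmalgamData {
  amalgA : {linear E -> Y};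
  amalgB : {linear E -> W};
  amalgp : E -> R;
  amalgc : R;
  amalgpD : forall x y, amalgp (x + y) <= amalgp x + amalgp y;
  amalgpZ : forall (l : R) x, amalgp (l *: x) = `|l| * amalgp x;
  amalgc_ge0 : 0 <= amalgc;
  amalgB_le : forall x, `|amalgB x| <= amalgc * amalgp x;
  amalgA_le : forall x, `|amalgA x| <= amalgp x + `|amalgB x| }.

(* The norm of Y * W is lowered so that (A x, - B x) has norm at most p x;
   the bound on A x makes this leave the norm on Y * 0 unchanged. *)
Definition amalgam (R : realType) (Y W : completeNormedModType R)
  (E : lmodType R) (D : amalgam_data Y W E) : Type := (Y * W)%type.

HB.instance Definition _ (R : realType) (Y W : completeNormedModType R)
  (E : lmodType R) (D : amalgam_data Y W E) :=
  GRing.Lmodule.copy (amalgam D) (Y * W)%type.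

Section AmalgamNorm.
Variables (R : realType) (Y W : completeNormedModType R) (E : lmodType R).
Variable D : amalgam_data Y W E.
Local Notation A := (amalgA D).
Local Notation B := (amalgB D).
Local Notation p := (amalgp D).
Local Notation c := (amalgc D).
Implicit Types z : amalgam D.

(** The infimum over x is the quotient norm of the l1-sum of [Y], ([E], [p]) and [W] under the map
    (y, x, w) -> (y + A x, w - B x). *)
Definition amalgam_cost z (x : E) : R := `|z.1 - A x| + p x + `|z.2 + B x|.

Definition amalgam_norm z : R := inf (range (amalgam_cost z)).

Let p_ge0 x : 0 <= p x.
Proof.
have := amalgpD D x (- x); rewrite subrr -scaleN1r amalgpZ normrN1 mul1r.
have := amalgpZ D 0 x; rewrite scale0r normr0 mul0r => ->.
by lra.
Qed.

Let p0 : p 0 = 0.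
Proof. by rewrite -(scale0r 0) amalgpZ normr0 mul0r. Qed.

Let cost_ge0 z x : 0 <= amalgam_cost z x.
Proof. by rewrite !addr_ge0. Qed.

Let norm_le z x : amalgam_norm z <= amalgam_cost z x.
Proof.
apply: ge_inf; last by exists x.
by exists 0 => _ [t _ <-]; exact: cost_ge0.
Qed.

Let le_norm z r : (forall x, r <= amalgam_cost z x) -> r <= amalgam_norm z.
Proof.
move=> h; apply: lb_le_inf; first by exists (amalgam_cost z 0), 0.
by move=> _ [x _ <-].
Qed.

Let norm_ge0 z : 0 <= amalgam_norm z.
Proof. by apply: le_norm => x; exact: cost_ge0. Qed.

Let norm_leD z1 z2 : amalgam_norm (z1 + z2) <= amalgam_norm z1 + amalgam_norm z2.
Proof.
rewrite -lerBlDr; apply: le_norm => x; rewrite lerBlDl -lerBlDr.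
apply: le_norm => y; rewrite lerBlDr.
apply: (le_trans (norm_le _ (x + y))).
rewrite /amalgam_cost (linearD A) (linearD B)/=.
have h1 : `|z1.1 + z2.1 - (A x + A y)| <= `|z1.1 - A x| + `|z2.1 - A y|.
  by rewrite opprD addrACA ler_normD.
have h2 : `|z1.2 + z2.2 + (B x + B y)| <= `|z1.2 + B x| + `|z2.2 + B y|.
  by rewrite addrACA ler_normD.

apply: (le_trans (lerD (lerD h1 (amalgpD D x y)) h2)).
by set a1 := `|z1.1 - _|; set a2 := `|z2.1 - _|; lra.
Qed.

Let normZ_le (l : R) z : l != 0 -> amalgam_norm (l *: z) <= `|l| * amalgam_norm z.
Proof.
move=> l0; rewrite mulrC -ler_pdivrMr ?normr_gt0//; apply: le_norm => x.
rewrite ler_pdivrMr ?normr_gt0//; apply: (le_trans (norm_le _ (l *: x))).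
rewrite /amalgam_cost (linearZ_LR A) (linearZ_LR B)/= -scalerBr -scalerDr !normrZ amalgpZ.
by rewrite -!mulrDr mulrC.
Qed.

Let normZ (l : R) z : amalgam_norm (l *: z) = `|l| * amalgam_norm z.
Proof.
have [->|l0] := eqVneq l 0.
  rewrite scale0r normr0 mul0r; apply/eqP; rewrite eq_le norm_ge0 andbT.
  apply: (le_trans (norm_le _ 0)).
  by rewrite /amalgam_cost (linear0 A) (linear0 B) p0/= subrr !addr0 !normr0 addr0.
apply/eqP; rewrite eq_le normZ_le//= mulrC -ler_pdivlMr ?normr_gt0//.
rewrite mulrC -normfV; apply: le_trans (normZ_le _ _); last by rewrite invr_eq0.
by rewrite scalerA mulVf// scale1r.
Qed.

Let norm_ge_snd z : `|z.2| <= (1 + c) * amalgam_norm z.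
Proof.
rewrite mulrC -ler_pdivrMr ?ltr_pwDl ?amalgc_ge0//; apply: le_norm => x.
rewrite ler_pdivrMr ?ltr_pwDl ?amalgc_ge0// mulrDr mulr1.
have h1 : `|z.2| <= `|z.2 + B x| + `|B x|.
  by rewrite -[in leLHS](addrK (B x) z.2) ler_normB.
have h2 := amalgB_le D x; have h3 := normr_ge0 (z.1 - A x).
have h4 := normr_ge0 (z.2 + B x); have h5 := p_ge0 x.
rewrite /amalgam_cost in h1 h2 *.
have h6 : 0 <= (`|z.1 - A x| + `|z.2 + B x|) * c.
  by rewrite mulr_ge0 ?addr_ge0 ?amalgc_ge0.
nra.
Qed.

Let norm_ge_fst z : `|z.1| <= (1 + c) * amalgam_norm z.
Proof.
rewrite mulrC -ler_pdivrMr ?ltr_pwDl ?amalgc_ge0//; apply: le_norm => x.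
rewrite ler_pdivrMr ?ltr_pwDl ?amalgc_ge0// mulrDr mulr1.
have h1 : `|z.1| <= `|z.1 - A x| + `|A x|.
  by rewrite -[in leLHS](subrK (A x) z.1) ler_normD.
have h2 := amalgB_le D x; have h3 := normr_ge0 (z.1 - A x).
have h4 := normr_ge0 (z.2 + B x); have h5 := amalgA_le D x.
rewrite /amalgam_cost in h1 h2 h5 *.
have h6 : 0 <= (`|z.1 - A x| + `|z.2 + B x|) * c.
  by rewrite mulr_ge0 ?addr_ge0 ?amalgc_ge0.
nra.
Qed.

Let norm0_eq0 z : amalgam_norm z = 0 -> z = 0.
Proof.
move=> z0; have := norm_ge_fst z; have := norm_ge_snd z.
rewrite z0 !mulr0 !normr_le0 => /eqP z2 /eqP z1.
by case: z z1 z2 {z0} => [z1 z2]/= -> ->.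
Qed.

HB.instance Definition _ := Lmodule_isNormed.Build R (amalgam D)
  norm_leD normZ norm0_eq0.

Lemma amalgam_norm_le z x : `|z| <= `|z.1 - A x| + p x + `|z.2 + B x|.
Proof. exact: norm_le. Qed.

Definition amalgam_inl (y : Y) : amalgam D := (y, 0).

Lemma amalgam_inl_linear : linear amalgam_inl.
Proof.
by move=> l x y; congr pair; rewrite /= scaler0 addr0.
Qed.

HB.instance Definition _ := GRing.isLinear.Build R Y (amalgam D) *:%R
  amalgam_inl amalgam_inl_linear.

Definition amalgam_inr (w : W) : amalgam D := (0, w).

Lemma amalgam_inr_linear : linear amalgam_inr.
Proof. by move=> l x y; congr pair; rewrite /= scaler0 addr0. Qed.

HB.instance Definition _ := GRing.isLinear.Build R W (amalgam D) *:%R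
  amalgam_inr amalgam_inr_linear.

(** Taking x = 0 gives the upper bound; the lower one is |y| <= |y - A x| + |A x| followed by
    [amalgA_le]. *)
Lemma amalgam_inl_norm (y : Y) : `|amalgam_inl y| = `|y|.
Proof.
apply/eqP; rewrite eq_le; apply/andP; split.
  apply: (le_trans (amalgam_norm_le _ 0)).
  by rewrite (linear0 A) (linear0 B) p0/= subr0 !addr0 normr0 addr0.
apply: le_norm => x; rewrite /amalgam_cost/= add0r -addrA.
have h1 : `|y| <= `|y - A x| + `|A x|.
  by rewrite -[in leLHS](subrK (A x) y) ler_normD.
by apply: (le_trans h1); rewrite lerD2l; exact: amalgA_le.
Qed.

(** Both coordinates are (1 + c)-Lipschitz for the new norm, so they converge; the cost at x = 0
    turns this into convergence in the new norm. *)
Lemma amalgam_complete (F : set_system (amalgam D)) :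
  ProperFilter F -> cauchy F -> cvg F.
Proof.
move=> FF Fc.
have c1 : 0 < 1 + c by rewrite ltr_pwDl ?amalgc_ge0.
have cauchy_proj (V : completeNormedModType R) (f : amalgam D -> V) :
    (forall z1 z2, `|f z1 - f z2| <= (1 + c) * `|z1 - z2|) -> cvg (f @ F).
  move=> fl; apply: cauchy_cvg; apply: cauchy_exP => e e0.
  have /cauchyP /(_ (e / (1 + c)))[|z Fz] := Fc; first by rewrite divr_gt0.
  exists (f z); rewrite /nbhs/=; apply: filterS Fz => z'.
  rewrite -!ball_normE/= => zz'; apply: (le_lt_trans (fl _ _)).
  by rewrite mulrC -ltr_pdivlMr.
have /cvg_ex[y yF] := cauchy_proj Y fst (fun z1 z2 => norm_ge_fst (z1 - z2)).
have /cvg_ex[w wF] := cauchy_proj W snd (fun z1 z2 => norm_ge_snd (z1 - z2)).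
apply/cvg_ex; exists ((y, w) : amalgam D).
apply/cvgrPdist_lt => e e0.
have e2 : 0 < e / 2 by rewrite divr_gt0.
near=> z.
apply: (le_lt_trans (amalgam_norm_le _ 0)).
rewrite (linear0 A) (linear0 B) p0/= subr0 !addr0 (splitr e) ltrD//.
  by near: z; move/cvgrPdist_lt : yF; apply.
by near: z; move/cvgrPdist_lt : wF; apply.
Unshelve. all: by end_near. Qed.

HB.instance Definition _ := Uniform_isComplete.Build (amalgam D) amalgam_complete.

End AmalgamNorm.

(** * Orthogonal projections and the distance from the identity to low rank *)

Section OrthogonalProjection.
Variable R : realType.

Lemma mxtrace_mul_tr (m n : nat) (A : 'M[R]_(m, n)) :
  \tr (A *m A^T) = \sum_i \sum_j A i j ^+ 2.
Proof.
apply: eq_bigr => i _; rewrite mxE; apply: eq_bigr => j _.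
by rewrite mxE expr2.
Qed.

(** [P] projects orthogonally onto the row space of [b]. By Gram-Schmidt, the part v of a new row
    orthogonal to the earlier ones adds the projection v^T v / |v|^2, of trace 1; if v = 0, [P] is
    kept. *)
Lemma exists_projection (k n : nat) (b : 'M[R]_(k, n)) :
  exists P : 'M[R]_n,
    [/\ P^T = P, P *m P = P, b *m P = b & \tr P <= k%:R].
Proof.
elim: k b => [|k IH] b.
  exists 0; rewrite trmx0 mul0mx mulmx0 mxtrace0; split=> //.
  by apply/matrixP => -[].
pose u : 'rV[R]_n := @usubmx R 1 k n b.
have [P [PT PP bP trP]] := IH (@dsubmx R 1 k n b).
have bE : b = col_mx u (@dsubmx R 1 k n b) by rewrite (@vsubmxK R 1 k n).
pose v := u - u *m P.
pose s := \tr (v *m v^T).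
have vP : v *m P = 0 by rewrite mulmxBl -mulmxA PP subrr.
have Pv : P *m v^T = 0 by rewrite -[P]PT -trmx_mul vP trmx0.
have vv : v *m v^T = s%:M by rewrite [LHS]mx11_scalar /s trace_mx11.
have [v0|v0] := eqVneq v 0.
  exists P; split=> //; last by apply: (le_trans trP); rewrite ler_nat.
  have uP : u *m P = u by apply/esym/eqP; rewrite -subr_eq0 -/v v0.
  by rewrite [in LHS]bE (@mul_col_mx R 1) bP uP -bE.
have s0 : s != 0.
  apply: contra v0 => /eqP; rewrite /s mxtrace_mul_tr => /eqP.
  rewrite big_ord1 psumr_eq0 => [/allP h|j _]; last exact: sqr_ge0.
  apply/eqP/rowP => j; have := h j; rewrite mem_index_enum => /(_ isT).
  by rewrite /= sqrf_eq0 [RHS]mxE => /eqP.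
have uv : u *m v^T = s%:M.
  by rewrite -vv {2}/v mulmxBl -mulmxA Pv mulmx0 subr0.
have Pw : P *m (v^T *m v) = 0 by rewrite mulmxA Pv mul0mx.
have wP : (v^T *m v) *m P = 0 by rewrite -mulmxA vP mulmx0.
have ww : (v^T *m v) *m (v^T *m v) = s *: (v^T *m v).
  by rewrite -mulmxA (mulmxA v) vv mul_scalar_mx -scalemxAr.
exists (P + s^-1 *: (v^T *m v)); split.
- by rewrite linearD/= PT linearZ/= trmx_mul trmxK.
- move: (v^T *m v) Pw wP ww => w Pw wP ww.
  rewrite mulmxDl !mulmxDr PP -!scalemxAr -!scalemxAl Pw wP ww.
  by rewrite !scaler0 addr0 add0r [s^-1 *: (s *: w)]scalerA mulVf// scale1r.
- rewrite [in LHS]bE (@mul_col_mx R 1) [RHS]bE; congr (@col_mx R 1 k n _ _).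
    rewrite mulmxDr -scalemxAr mulmxA uv mul_scalar_mx scalerA mulVf// scale1r.
    by rewrite addrC subrK.
  have bw : @dsubmx R 1 k n b *m (v^T *m v) = 0 by rewrite -bP -mulmxA Pw mulmx0.
  by rewrite mulmxDr -scalemxAr bP bw scaler0 addr0.
- rewrite linearD/= linearZ/= mxtrace_mulC -/s mulVf// -natr1.
  by rewrite lerD2r.
Qed.

(** With [P] fixing the rows of [b], (I - C b)(I - P) = I - P. By Pythagoras the squared
    Hilbert-Schmidt norm of I - C b is at least that of I - P, which is tr(I - P) >= n - k. *)
Lemma identity_low_rank_distance (k n : nat) (b : 'M[R]_(k, n)) (C : 'M[R]_(n, k)) :
  n%:R - k%:R <= \sum_i \sum_j ((1%:M - C *m b) i j) ^+ 2.
Proof.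
have [P [PT PP bP trP]] := exists_projection b.
rewrite -mxtrace_mul_tr; set E := 1%:M - _.
have EP : E *m (1%:M - P) = 1%:M - P.
  rewrite mulmxBl mul1mx mulmxBr mulmx1 -[X in _ - (_ - X)]mulmxA bP subrr subr0.
  by [].
have PPT : (1%:M - P) *m (1%:M - P)^T = 1%:M - P.
  by rewrite linearB/= trmx1 PT mulmxBr mulmx1 mulmxBl mul1mx PP subrr subr0.
have -> : E *m E^T = (E *m P) *m (E *m P)^T + (E *m (1%:M - P)) *m (E *m (1%:M - P))^T.
  rewrite !trmx_mul !mulmxA -(mulmxA E P) -(mulmxA E (1%:M - P)) PPT PT PP.
  by rewrite -mulmxDl -mulmxDr addrC subrK mulmx1.
rewrite EP PPT mxtraceD linearB/= mxtrace1.
have : 0 <= \tr ((E *m P) *m (E *m P)^T).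
  rewrite mxtrace_mul_tr; apply: sumr_ge0 => i _; apply: sumr_ge0 => j _.
  exact: sqr_ge0.
lra.
Qed.

End OrthogonalProjection.

(** * Bounds for widths and operator norms *)

Section Widths.
Variable R : realType.

(** [has_dim] asks for independent vectors, so a vector that depends on the others is dropped until
    none is left. *)
Lemma subspace_dim_le_span (X : normedModType R) (p : nat) (v : 'I_p -> X) :
  subspace_dim_le p (lin_span v).
Proof.
elim: p v => [|p IH] v; first by exists 0%N => //; exists v => // c _ [].
have [vind|] := pselect (lin_indep v); first by exists p.+1 => //; exists v.
move=> /existsNP[c] /not_implyP[cv] /existsNP[j] /eqP cj.
suff -> : lin_span v = lin_span (fun i => v (lift j i)).
  by have [k kp kV] := IH (fun i => v (lift j i)); exists k => //; exact: leqW.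
have big_lift (F : 'I_p.+1 -> X) : \sum_i F i = F j + \sum_i F (lift j i).
  rewrite (bigD1 j)//=; congr (_ + _); rewrite (reindex_omap (lift j) (unlift j))/=.
    apply: eq_bigl => i; rewrite liftK eqxx andbT.
    by rewrite eq_sym neq_lift.
  by move=> i ij; case: unliftP ij => [i' ->//|->]; rewrite eqxx.
apply/seteqP; split=> x [d _ <-].
  exists (fun i => d (lift j i) - d j / c j * c (lift j i)) => //.
  rewrite big_lift; under eq_bigr do rewrite scalerBl -scalerA.
  rewrite sumrB -scaler_sumr addrC; congr (_ + _).
  move: cv; rewrite big_lift => /eqP; rewrite addr_eq0 => /eqP cv.
  by rewrite -[X in _ *: X]opprK -cv scalerN opprK scalerA divfK.
exists (fun i => oapp d 0 (unlift j i)) => //.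
rewrite big_lift unlift_none/= scale0r add0r.
by apply: eq_bigr => i _; rewrite liftK.
Qed.

Lemma kolmogorov_width_le (X : normedModType R) (n : nat) (K V : set X) (d : R) :
  subspace_dim_le n V -> (forall x, K x -> exists2 z, V z & `|x - z| <= d) ->
  (kolmogorov_width n K <= d%:E)%E.
Proof.
move=> Vn KV; apply: ereal_inf_le.
exists (ereal_sup [set ereal_inf [set (`|x - z|)%:E | z in V] | x in K])%E.
  by exists V.
apply: ge_ereal_sup => _ [x Kx <-]; have [z Vz xz] := KV x Kx.
by apply: ge_ereal_inf; exists (`|x - z|)%:E; [exists z|rewrite lee_fin].
Qed.

Lemma le_kolmogorov_width (X : normedModType R) (n : nat) (K : set X) (c : R) :
  (forall k (e : 'I_k -> X), (k <= n)%N ->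
    exists2 x, K x & forall z, lin_span e z -> c <= `|x - z|) ->
  (c%:E <= kolmogorov_width n K)%E.
Proof.
move=> cK; apply: le_ereal_inf_tmp => _ [V [k kn [e _ ->]] <-].
have [x Kx xc] := cK k e kn.
apply: le_ereal_sup_tmp; exists (ereal_inf [set (`|x - z|)%:E | z in lin_span e]).
  by exists x.
by apply: le_ereal_inf_tmp => _ [z zV <-]; rewrite lee_fin xc.
Qed.

Lemma absolute_width_le (Y Z : completeNormedModType R) (iota : {linear Y -> Z})
    (n : nat) (K : set Y) (V : set Z) (d : R) :
  (forall y, `|iota y| = `|y|) -> subspace_dim_le n V ->
  (forall x, K x -> exists2 z, V z & `|iota x - z| <= d) ->
  (absolute_width n K <= d%:E)%E.
Proof.
move=> iotaP Vn KV; apply: ge_ereal_inf; exists (kolmogorov_width n (iota @` K)).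
  by exists Z, iota.
by apply: (kolmogorov_width_le Vn) => _ [x Kx <-]; exact: KV.
Qed.

Lemma absolute_width_ge0 (Y : completeNormedModType R) (n : nat) (K : set Y) :
  K !=set0 -> (0 <= absolute_width n K)%E.
Proof.
move=> [x Kx]; apply: le_ereal_inf_tmp => _ [Z [iota [_ ->]]].
apply: le_kolmogorov_width => k e _; by exists (iota x).
Qed.

Lemma width_ratio_ge (w v : \bar R) (c d C : R) :
  (c%:E <= w)%E -> (0 <= v)%E -> (v <= d%:E)%E ->
  0 < c -> 0 <= C -> C * d <= c -> (C%:E <= w / v)%E.
Proof.
move=> cw v0 vd c0 C0 Cdc.
have w0 : (0 < w)%E by apply: lt_le_trans cw; rewrite lte_fin.
case: v v0 vd => [v| |]//; rewrite !lee_fin => v0 vd.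
(* For v = 0 the inverse in [\bar R] is +oo, and so is the ratio because w > 0. *)
have [->|v_neq0] := eqVneq v 0.
  by rewrite inver eqxx gt0_muley// leey.
have v_gt0 : 0 < v by rewrite lt_neqAle eq_sym v_neq0.
rewrite inver (negbTE v_neq0) lee_pdivlMr//; apply: le_trans cw.
by rewrite -EFinM lee_fin; apply: le_trans Cdc; rewrite ler_wpM2l.
Qed.

Lemma opnorm_ge0 (U V : normedModType R) (f : {linear U -> V}) :
  (0 <= opnorm f)%E.
Proof.
apply: ereal_sup_ubound; exists 0; rewrite /= ?normr0//.
by rewrite linear0 normr0.
Qed.

Lemma opnorm_bound (U V : normedModType R) (f : {linear U -> V}) :
  (opnorm f < +oo)%E ->
  exists2 a : R, opnorm f = a%:E & forall x, `|f x| <= a * `|x|.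
Proof.
move=> foo; have := opnorm_ge0 f.
case E : (opnorm f) foo => [a| |]// _ a0; exists a => // x.
have [->|x0] := eqVneq x 0; first by rewrite linear0 !normr0 mulr0.
rewrite -ler_pdivrMr ?normr_gt0// -lee_fin -E.
apply: ereal_sup_ubound; exists (`|x|^-1 *: x) => /=.
  by rewrite normrZ normfV normr_id mulVf// normr_eq0.
by rewrite linearZ/= normrZ normfV normr_id mulrC.
Qed.

End Widths.

(** * Widths of the images of the unit vectors *)

HB.instance Definition _ (R : realType) (m n : nat) :=
  Uniform_isComplete.Build 'M[R]_(m, n) (@mx_complete R m n).

Definition unit_vector (R : realType) (n : nat) (i : 'I_n) : l2 R n :=
  delta_mx ord0 i : 'rV[R]_n.

Definition l2_mulmx (R : realType) (n k : nat) (M : 'M[R]_(n, k)) (x : l2 R n)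
  : 'rV[R]_k := (x : 'rV[R]_n) *m M.

Lemma l2_mulmx_linear (R : realType) (n k : nat) (M : 'M[R]_(n, k)) :
  linear (l2_mulmx M).
Proof. by move=> l x y; rewrite /l2_mulmx mulmxDl scalemxAl. Qed.

HB.instance Definition _ (R : realType) (n k : nat) (M : 'M[R]_(n, k)) :=
  GRing.isLinear.Build R (l2 R n) 'rV[R]_k *:%R (l2_mulmx M) (l2_mulmx_linear M).

Section FactorizationWidths.
Variables (R : realType) (Y : completeNormedModType R) (n : nat).
Variable A : {linear l2 R n -> Y}.

Lemma norm_unit_vector (i : 'I_n) : `|unit_vector R i| = 1.
Proof.
rewrite l2normE /l2norm (bigD1 i)//= mxE !eqxx expr1n big1 ?addr0 ?sqrtr1//.
by move=> j ji; rewrite mxE (negbTE ji) andbF expr0n.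
Qed.

(** If every A e_i were closer than 1/(2b) to a span of k <= n/2 vectors, [B] would give a matrix of
    rank at most k whose difference from I has rows of squared norm at most 1/4: a total of n/4,
    less than n - k. *)
Lemma le_kolmogorov_width_factor (B : {linear Y -> l2 R n}) (b : R) (m : nat)
    (K : set Y) :
  (forall x, B (A x) = x) -> 0 < b -> (forall y, `|B y| <= b * `|y|) ->
  (0 < n)%N -> (m * 2 <= n)%N -> (forall i, K (A (unit_vector R i))) ->
  (((2 * b)^-1)%:E <= kolmogorov_width m K)%E.
Proof.
move=> BA b0 Bb n0 mn KA; apply: le_kolmogorov_width => k e km.
apply: contrapT => /forall2NP far.
have {}far i : exists c : 'I_k -> R,
    `|A (unit_vector R i) - \sum_l c l *: e l| < (2 * b)^-1.
  have [//|/existsNP[z /not_implyP[[c _ <-]] /negP]] := far (A (unit_vector R i)).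
  by rewrite -ltNge; exists c.
have /choice[c cP] := far.
pose Be : 'M[R]_(k, n) := \matrix_(l, j) (B (e l) : 'rV[R]_n) ord0 j.
pose C : 'M[R]_(n, k) := \matrix_(i, l) c i l.
have := identity_low_rank_distance Be C.
have row_le i : \sum_j ((1%:M - C *m Be) i j) ^+ 2 <= 4^-1.
  have -> : \sum_j ((1%:M - C *m Be) i j) ^+ 2
      = `|B (A (unit_vector R i) - \sum_l c i l *: e l)| ^+ 2.
    rewrite l2normE l2norm_sqr; apply: eq_bigr => j _; congr (_ ^+ 2).
    rewrite linearB/= BA linear_sum/= [RHS]mxE [LHS]mxE; congr (_ + _).
      by rewrite !mxE eqxx eq_sym.
    rewrite [LHS]mxE [RHS]mxE; congr (- _); rewrite [LHS]mxE summxE.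
    by apply: eq_bigr => l _; rewrite linearZ !mxE.
  have -> : 4^-1 = (b * (2 * b)^-1) ^+ 2 :> R by field; rewrite gt_eqF.
  rewrite lerXn2r ?nnegrE ?mulr_ge0 ?invr_ge0 ?mulr_ge0 ?(ltW b0)//.
  apply: (le_trans (Bb _)); rewrite ler_wpM2l ?(ltW b0)// ltW//.
have sum_le : \sum_i \sum_j ((1%:M - C *m Be) i j) ^+ 2 <= n%:R * 4^-1.
  apply: (le_trans (ler_sum _ (fun i _ => row_le i))).
  by rewrite sumr_const card_ord mulr_natl.
have nR : 0 < n%:R :> R by rewrite ltr0n.
have kn : k%:R * 2 <= n%:R :> R.
  by rewrite -natrM ler_nat (leq_trans _ mn)// leq_mul2r km orbT.
move: sum_le; set S := \sum_i _ => h1 h2; lra.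
Qed.

(** In the amalgam with p = d |x|_1, d = 6 a / sqrt N, the space spanned by [s] and R^k contains
    [s], is within d of each A e_i, and its point 0 serves the small elements of [K]. *)
Lemma absolute_width_le_l1 (a : R) (k N : nat) (s : seq Y) (K : set Y) :
  0 < a -> (forall x, `|A x| <= a * `|x|) ->
  (0 < k)%N -> (0 < N)%N -> ((n * 2) ^ N)%:R < (23 / 22 : R) ^+ k ->
  (forall x, K x -> [\/ x \in s, exists i, x = A (unit_vector R i) |
                       `|x| <= a * (6 / Num.sqrt N%:R)]) ->
  (absolute_width (k + size s) K <= (a * (6 / Num.sqrt N%:R))%:E)%E.
Proof.
move=> a0 Aa k0 N0 nNk Ks.
have [G GP] := exists_l2_le_l1_matrix k0 N0 nNk.
pose d := a * (6 / Num.sqrt N%:R).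
have d0 : 0 < d by rewrite mulr_gt0 ?divr_gt0 ?sqrtr_gt0 ?ltr0n.
(* The factor 4 a makes [Ale] the inequality of [exists_l2_le_l1_matrix] multiplied by a. *)
pose M : 'M[R]_(n, k) := \matrix_(j, r) (4 * a * G r j).
pose p (x : l2 R n) : R := d * \sum_j `|(x : 'rV[R]_n) ord0 j|.
pose c : R := d^-1 * \sum_r \sum_j `|M j r|.
have pD x y : p (x + y) <= p x + p y.
  rewrite -mulrDr ler_wpM2l ?(ltW d0)// -big_split/=; apply: ler_sum => j _.
  by rewrite mxE ler_normD.
have pZ (l : R) x : p (l *: x) = `|l| * p x.
  rewrite /p mulrCA; congr (_ * _); rewrite mulr_sumr; apply: eq_bigr => j _.
  by rewrite mxE normrM.
have c0 : 0 <= c.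
  rewrite mulr_ge0 ?invr_ge0 ?(ltW d0)//.
  by apply: sumr_ge0 => r _; apply: sumr_ge0 => j _.
have Mle x : `|l2_mulmx M x| <= c * p x.
  have -> : c * p x = (\sum_r \sum_j `|M j r|) * \sum_j `|(x : 'rV[R]_n) ord0 j|.
    by rewrite /c /p; field; rewrite gt_eqF.
  rewrite [leLHS]mx_normrE; apply: bigmax_le => [|[i r] _].
    by rewrite mulr_ge0//; apply: sumr_ge0 => // r _; apply: sumr_ge0.
  rewrite ord1 /= mxE; apply: (le_trans (ler_norm_sum _ _ _)).
  rewrite mulr_sumr; apply: ler_sum => j _; rewrite normrM mulrC.
  apply: ler_wpM2r => //; rewrite (bigD1 r)//= (bigD1 j)//= -addrA lerDl.
  rewrite addr_ge0//; apply: sumr_ge0 => // r' _; exact: sumr_ge0.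
have Ale x : `|A x| <= p x + `|l2_mulmx M x|.
  apply: (le_trans (Aa x)); rewrite l2normE.
  have := GP (fun j => (x : 'rV[R]_n) ord0 j) (`|l2_mulmx M x| / (4 * a)).
  move=> /(_ _)/(ler_wpM2l (ltW a0)) => h.
  apply: le_trans (h _) _ => [r|].
    rewrite ler_pdivlMr ?mulr_gt0// mulrC -[X in X * _](ger0_norm (ltW _)) ?mulr_gt0//.
    rewrite -normrM mulr_sumr [leRHS]mx_normrE.
    apply: le_trans (le_bigmax _ _ (ord0, r)); rewrite /= mxE.
    rewrite le_eqVlt; apply/orP; left; apply/eqP; congr (`|_|).
    by apply: eq_bigr => j _; rewrite mxE; ring.
  rewrite le_eqVlt; apply/orP; left; apply/eqP.
  have sN : Num.sqrt N%:R != 0 :> R by rewrite gt_eqF// sqrtr_gt0 ltr0n.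
  by rewrite /p /d; field; rewrite ?sN ?(gt_eqF a0).
pose D := @AmalgamData R Y 'rV[R]_k (l2 R n) A
  (l2_mulmx M : {linear l2 R n -> 'rV[R]_k}) p c pD pZ c0 Mle Ale.
pose e (i : 'I_(k + size s)) : amalgam D :=
  match fintype.split i with
  | inl r => amalgam_inr D (delta_mx ord0 r)
  | inr i => amalgam_inl D (nth 0 s i)
  end.
apply: (@absolute_width_le _ _ _ (amalgam_inl D) _ K (lin_span e)).
- exact: amalgam_inl_norm.
- exact: subspace_dim_le_span.
move=> x /Ks[xs|[i ->]|xd].
- exists (amalgam_inl D x); last by rewrite subrr normr0 ltW.
  have xi : (index x s < size s)%N by rewrite index_mem.
  exists (fun i => (i == rshift k (Ordinal xi))%:R) => //.
  rewrite (bigD1 (rshift k (Ordinal xi)))//= eqxx scale1r big1 ?addr0.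
    by rewrite /e (unsplitK (inr (Ordinal xi)))/= nth_index.
  by move=> j /negbTE->; rewrite scale0r.
- pose w := l2_mulmx M (unit_vector R i).
  exists (amalgam_inr D w).
    exists (fun l => if fintype.split l is inl r then w ord0 r else 0) => //.
    rewrite big_split_ord/= [X in _ + X]big1 ?addr0 => [|l _]; last first.
      by rewrite (unsplitK (inr l)) scale0r.
    rewrite [in RHS](row_sum_delta w) linear_sum; apply: eq_bigr => r _.
    by rewrite /e (unsplitK (inl r)) linearZ.
  (* The choice x = e_i cancels both coordinates and leaves only p e_i = d. *)
  apply: (le_trans (amalgam_norm_le _ (unit_vector R i))).
  have -> : (amalgam_inl D (A (unit_vector R i)) - amalgam_inr D w).1
    = A (unit_vector R i) by exact: subr0.
  have -> : (amalgam_inl D (A (unit_vector R i)) - amalgam_inr D w).2 = - w.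
    exact: sub0r.
  rewrite /= subrr normr0 add0r addNr normr0 addr0.
  rewrite /p (bigD1 i)//= mxE !eqxx normr1 big1 ?addr0 ?mulr1// => j ji.
  by rewrite mxE (negbTE ji) andbF normr0.
- exists 0; last by rewrite subr0 amalgam_inl_norm.
  by exists (fun=> 0) => //; rewrite big1// => l _; rewrite scale0r.
Qed.

End FactorizationWidths.

(** * The number of atoms allowed by the union bound *)

Section Growth.
Variable R : realType.

Lemma ln_lt_powR (t x : R) : 0 < t -> 0 < x -> ln x < x `^ t / t.
Proof.
move=> t0 x0; rewrite ltr_pdivlMr// mulrC -ln_powR.
by apply: ln_sublinear; exact: powR_gt0.
Qed.

(** N is about D^2 n^(2 sigma), so N ln(2n) is of smaller order than n, since 2 sigma < 1. *)
Lemma exists_atom_number (sigma D : R) :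
  0 <= sigma -> sigma < 1 / 2 -> 0 <= D ->
  exists n1, forall n, (n1 <= n)%N -> exists N,
    [/\ (0 < N)%N, D * n%:R `^ sigma <= Num.sqrt N%:R &
        ((n * 2) ^ N)%:R < (23 / 22 : R) ^+ (n %/ 4)].
Proof.
move=> s0 s1 D0; pose t : R := (1 - 2 * sigma) / 2.
have t0 : 0 < t by rewrite /t; lra.
(* 368 = 2 * 8 * 23: the 2 comes from the bound on ln(2n), the 8 from n/8 <= n %/ 4, the 23 from
   ln(23/22) >= 1/23. *)
pose X : R := 368 * (D ^+ 2 + 1) / t.
have X0 : 0 < X by rewrite divr_gt0// mulr_gt0// ltr_wpDl// sqr_ge0.
exists (maxn 8 (Num.truncn (X `^ t^-1)).+1) => n; rewrite geq_max => /andP[n8 nX].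
have n0 : (0 < n)%N by apply: leq_trans n8.
pose x : R := n%:R.
have x0 : 0 < x by rewrite ltr0n.
have x1 : 1 <= x by rewrite ler1n.
have Xx : X <= x `^ t.
  have Xt : X `^ t^-1 <= x.
    by apply/ltW/(lt_le_trans (truncnS_gt _)); rewrite ler_nat.
  have : (X `^ t^-1) `^ t <= x `^ t.
    by apply: (ge0_ler_powR (ltW t0)) Xt; rewrite nnegrE ?powR_ge0 ?(ltW x0).
  by rewrite -powRrM mulVf ?gt_eqF// powRr1 ?(ltW X0).
pose Q := (D * x `^ sigma) ^+ 2.
have Q0 : 0 <= Q by exact: sqr_ge0.
pose N := (Num.truncn Q).+1.
have NR : N%:R <= (D ^+ 2 + 1) * x `^ (2 * sigma).
  have xs1 : 1 <= x `^ (2 * sigma).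
    by rewrite -[leLHS](@powRr0 _ x); apply: ler_powR => //; rewrite mulr_ge0.
  have QE : Q = D ^+ 2 * x `^ (2 * sigma).
    by rewrite /Q exprMn [2 * sigma]mulrC powRrM powR_mulrn ?powR_ge0.
  have := truncn_le Q; rewrite Q0 => QN.
  by rewrite /N -natr1 mulrDl mul1r -QE lerD.
exists N; split=> //.
  rewrite -[leLHS]ger0_norm ?mulr_ge0 ?powR_ge0// -sqrtr_sqr ler_sqrt//.
  exact/ltW/truncnS_gt.
have n2 : 0 < (n * 2)%:R :> R by rewrite ltr0n muln_gt0 n0.
rewrite natrX -ltr_ln ?posrE ?exprn_gt0 ?divr_gt0// !lnXn ?divr_gt0//.
rewrite -[ltLHS]mulr_natl -[ltRHS]mulr_natl.
have ln_ge : 23^-1 <= ln (23 / 22 : R).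
  have := @le_ln1Dx R (- 23^-1); rewrite (_ : 1 + - 23^-1 = (23 / 22)^-1 :> R); last by field.
  by rewrite lnV ?posrE ?divr_gt0// lerNl opprK; apply; lra.
have n4 : x / 8 <= (n %/ 4)%:R.
  have : x <= 4 * (n %/ 4)%:R + 3.
    rewrite /x {1}(divn_eq n 4) mulnC natrD natrM lerD2l ler_nat -ltnS.
    exact: ltn_pmod.
  have : 8 <= x by rewrite ler_nat.
  lra.
have ln_n : ln (n * 2)%:R < 2 * x `^ t / t.
  apply: (lt_le_trans (ln_lt_powR t0 n2)); rewrite ler_pM2r ?invr_gt0//.
  rewrite natrM mulrC powRM ?(ltW x0)//; apply: ler_wpM2r; first exact: powR_ge0.
  rewrite -[leRHS](@powRr1 _ 2)//; apply: ler_powR; first by rewrite ler1n.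
  by rewrite /t; lra.
(* Of the two factors x^t, one absorbs the logarithm and the other the constant [X]. *)
have xE : x = x `^ (2 * sigma) * x `^ t * x `^ t.
  rewrite -!powRD ?(gt_eqF x0) ?implybT// (_ : _ + _ = 1) ?powRr1 ?ltW//.
  by rewrite /t; lra.
set L := ln _ in ln_n *.
have L_ge0 : 0 <= L by rewrite ln_ge0// ler1n muln_gt0 n0.
have step1 : N%:R * L < (D ^+ 2 + 1) * x `^ (2 * sigma) * (2 * x `^ t / t).
  apply: (le_lt_trans (ler_wpM2r L_ge0 NR)); rewrite ltr_pM2l//.
  by rewrite mulr_gt0 ?powR_gt0// ltr_wpDl// sqr_ge0.
apply: (lt_le_trans step1).
have step2 : x / 8 * 23^-1 <= (n %/ 4)%:R * ln (23 / 22 : R).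
  by apply: ler_pM => //; rewrite ?divr_ge0 ?(ltW x0).
apply: le_trans step2.
have -> : (D ^+ 2 + 1) * x `^ (2 * sigma) * (2 * x `^ t / t)
    = (x `^ (2 * sigma) * x `^ t) * X / 8 / 23.
  by rewrite /X; field; rewrite gt_eqF.
rewrite [in leRHS]xE !ler_pM2r ?invr_gt0//; apply: ler_wpM2l => //.
by rewrite mulr_ge0 ?powR_ge0.
Qed.

End Growth.

(** * Compactness of null sequences *)

Section NullSequences.
Variables (R : realType) (X : normedModType R).

(** A filter on [K] that does not cluster at 0 contains some part of [K] with norms at least e; that
    part is finite, hence compact. *)
Lemma compact_finite_away_from_0 (K : set X) :
  K 0 -> (forall e : R, 0 < e -> finite_set (K `&` [set x | e <= `|x|])) ->
  compact K.
Proof.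
move=> K0 Kfin F FF FK; have [c0|] := pselect (cluster F 0); first by exists 0.
move=> /existsNP[A /existsNP[B /not_implyP[FA /not_implyP[B0 AB]]]].
have /nbhs_ballP[e /= e0 eB] := B0.
have FKe : F (K `&` [set x | e <= `|x|]).
  apply: (filterS _ (filterI FK FA)) => x [Kx Ax]; split=> //=.
  rewrite leNgt; apply/negP => xe; apply: AB; exists x; split=> //.
  by apply: eB; rewrite -ball_normE/= sub0r normrN.
have [p [[Kp _] Fp]] := finite_compact (Kfin e e0) FF FKe.
by exists p.
Qed.

End NullSequences.

(** * Construction of the compact set *)

Section Construction.
Variables (R : realType) (Y : completeNormedModType R) (gamma sigma : R).

Definition factors_l2 (n : nat) : Prop :=
  exists (A : {linear l2 R n -> Y}) (B : {linear Y -> l2 R n}),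
    [/\ (opnorm A < +oo)%E, (opnorm B < +oo)%E,
        forall x : l2 R n, B (A x) = x &
        (opnorm A * opnorm B <= (gamma * n%:R `^ sigma)%:E)%E].

Hypothesis gamma_gt0 : 0 < gamma.
Hypothesis sigma_ge0 : 0 <= sigma.
Hypothesis sigma_lt : sigma < 1 / 2.

(** Scaling [A] by eta / a and [B] by a / eta keeps the product of the norms; both norms are
    positive because B A fixes a unit vector. *)
Lemma factors_l2_normalized (n : nat) (eta : R) :
  (0 < n)%N -> 0 < eta -> factors_l2 n ->
  exists (A : {linear l2 R n -> Y}) (B : {linear Y -> l2 R n}) (b : R),
    [/\ 0 < b, b * eta <= gamma * n%:R `^ sigma,
        forall x, B (A x) = x, forall x, `|A x| <= eta * `|x| &
        forall y, `|B y| <= b * `|y|].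
Proof.
move=> n0 eta0 [A [B [Aoo Boo BA]]].
have [a -> Aa] := opnorm_bound Aoo.
have [b -> Bb] := opnorm_bound Boo.
rewrite -EFinM lee_fin => ab.
pose e := unit_vector R (Ordinal n0).
have BAe : 1 <= b * `|A e| by rewrite -(norm_unit_vector R (Ordinal n0)) -/e -{1}(BA e).
have Ae_gt0 : 0 < `|A e|.
  rewrite lt_neqAle normr_ge0 andbT; apply/negP => /eqP Ae0.
  by move: BAe; rewrite -Ae0 mulr0; lra.
have b0 : 0 < b by rewrite -(pmulr_lgt0 _ Ae_gt0); lra.
have a0 : 0 < a.
  by apply: (lt_le_trans Ae_gt0); rewrite -[leRHS]mulr1 -(norm_unit_vector R (Ordinal n0)).
have ea0 : 0 < eta / a by rewrite divr_gt0.
have ae0 : 0 < a / eta by rewrite divr_gt0.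
exists ((eta / a) \*: A), ((a / eta) \*: B), (a * b / eta).
split=> [||x|x|y].
- by rewrite divr_gt0// mulr_gt0.
- by rewrite divfK ?gt_eqF.
- by rewrite /= linearZ/= BA scalerA mulrC mulf_div [a * _]mulrC divff ?scale1r// mulf_neq0 ?gt_eqF.
- by rewrite /= normrZ (gtr0_norm ea0) -mulrA ler_pM2l// ler_pdivrMl.
- rewrite /= normrZ (gtr0_norm ae0) [a * b / eta]mulrAC -[leRHS]mulrA; apply: ler_wpM2l => //.
  exact: ltW.
Qed.

Hypothesis hY : infinite_set [set n : nat | (0 < n)%N /\ factors_l2 n].

(** [t] consists of the A e_i for a large n, and m = n %/ 4 + size s <= n/2 leaves room for [s] in
    the approximating space. [rho] is the bound on the absolute width, so elements below it cost
    nothing more. *)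
Lemma exists_stage (s : seq Y) (eta C : R) (n0 : nat) :
  0 < eta -> 0 <= C ->
  exists (t : seq Y) (m : nat) (rho : R),
    [/\ 0 < rho, (n0 <= m)%N, forall x, x \in t -> `|x| <= eta &
      forall K : set Y, (forall x, x \in t -> K x) ->
        (forall x, K x -> [\/ x \in s, x \in t | `|x| <= rho]) ->
        (C%:E <= kolmogorov_width m K / absolute_width m K)%E].
Proof.
move=> eta0 C0.
(* The ratio of the bounds 1/(2b) and 6 eta / sqrt N is sqrt N / (12 b eta), with b eta <= gamma
   n^sigma; hence this D. *)
have D0 : 0 <= C * 12 * gamma by rewrite !mulr_ge0 ?(ltW gamma_gt0).
have [n1 n1P] := exists_atom_number sigma_ge0 sigma_lt D0.
pose bound := (maxn n1 (4 * (n0 + size s).+1))%N.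
have [n [n_gt0 nF] bn] : exists2 n, (0 < n)%N /\ factors_l2 n & (bound <= n)%N.
  apply: contrapT => /forall2NP small; apply: hY.
  apply: (sub_finite_set _ (finite_II bound)) => n nY /=.
  by have [//|/negP] := small n; rewrite -ltnNge.
move: bn; rewrite geq_max => /andP[n1n n4].
have [N [N0 DN nNk]] := n1P n n1n.
have [A [B [b [b0 be BA Ae Bb]]]] := factors_l2_normalized n_gt0 eta0 nF.
pose k := (n %/ 4)%N.
have k_ge : (n0 + size s < k)%N by rewrite leq_divRL// mulnC.
have k0 : (0 < k)%N by apply: leq_trans k_ge.
have sN : 0 < Num.sqrt N%:R :> R by rewrite sqrtr_gt0 ltr0n.
pose rho := eta * (6 / Num.sqrt N%:R).
exists [seq A (unit_vector R i) | i <- enum 'I_n], (k + size s)%N, rho.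
split.
- by rewrite mulr_gt0 ?divr_gt0.
- by rewrite (leq_trans _ (leq_addr _ _))// (leq_trans (leq_addr (size s) _))// ltnW.
- move=> _ /mapP[i _ ->]; apply: (le_trans (Ae _)).
  by rewrite norm_unit_vector mulr1.
move=> K tK Ks.
have KA i : K (A (unit_vector R i)) by apply: tK; apply/mapP; exists i; rewrite ?mem_enum.
apply: (@width_ratio_ge _ _ _ (2 * b)^-1 rho).
- apply: (le_kolmogorov_width_factor BA b0 Bb) => //.
  have sk : (size s <= k)%N by rewrite ltnW// (leq_ltn_trans (leq_addl n0 _)).
  apply: (@leq_trans (k * 4)); last exact: leq_trunc_div.
  by rewrite mulnDl (_ : 4 = 2 + 2)%N// mulnDr leq_add2l leq_mul2r sk orbT.
- by apply: absolute_width_ge0; exists (A (unit_vector R (Ordinal n_gt0))).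
- apply: (absolute_width_le_l1 eta0 Ae k0 N0 nNk) => x /Ks[xs|/mapP[i _ ->]|xr].
  + by apply: Or31.
  + by apply: Or32; exists i.
  + by apply: Or33.
- by rewrite invr_gt0 mulr_gt0.
- by [].
rewrite -[leRHS]mulr1 ler_pdivlMl ?mulr_gt0// /rho.
have -> : 2 * b * (C * (eta * (6 / Num.sqrt N%:R)))
    = C * 12 * (b * eta) / Num.sqrt N%:R by ring.
rewrite ler_pdivrMr// mul1r; apply: le_trans DN.
by rewrite -[leRHS]mulrA; apply: ler_wpM2l => //; rewrite mulr_ge0.
Qed.

(** The state is the list of earlier points with the next norm bound, min(rho, eta/2): below rho for
    the current stage, halved so that norms tend to 0. *)
Lemma exists_stage_sequence :
  exists (t : nat -> seq Y) (s : nat -> seq Y) (m : nat -> nat) (eta : nat -> R),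
    [/\ forall j, 0 < eta j, forall j, eta j.+1 <= eta j / 2,
        forall j x, x \in t j -> `|x| <= eta j,
        forall j, s j.+1 = s j ++ t j &
        [/\ s 0%N = [::], forall j, (j <= m j)%N &
         forall j (K : set Y), (forall x, x \in t j -> K x) ->
           (forall x, K x -> [\/ x \in s j, x \in t j | `|x| <= eta j.+1]) ->
           (j%:R%:E <= kolmogorov_width (m j) K / absolute_width (m j) K)%E]].
Proof.
pose good (p : nat * (seq Y * R)) (q : seq Y * (nat * R)) :=
  let: (j, (s, eta)) := p in let: (t, (m, rho)) := q in 0 < eta ->
    [/\ 0 < rho, (j <= m)%N, forall x, x \in t -> `|x| <= eta &
      forall K : set Y, (forall x, x \in t -> K x) ->
        (forall x, K x -> [\/ x \in s, x \in t | `|x| <= rho]) ->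
        (j%:R%:E <= kolmogorov_width m K / absolute_width m K)%E].
have /choice[F FP] : forall p, exists q, good p q.
  move=> [j [s eta]]; have [eta0|eta0] := ltP 0 eta.
    have [t [m [rho h]]] := exists_stage s j eta0 (ler0n R j).
    by exists (t, (m, rho)).
  (* A default value for eta <= 0, a state never reached, makes [good] total for the choice. *)
  by exists ([::], (0%N, 0)) => /=; rewrite ltNge eta0.
pose st := fix st j : seq Y * R := if j is j'.+1 then
    let p := st j' in let q := F (j', p) in
    (p.1 ++ q.1, Num.min q.2.2 (p.2 / 2)) else ([::], 1).
have st0 j : 0 < (st j).2.
  elim: j => [|j IH] /=; first exact: ltr01.
  have := FP (j, st j); move: IH; case: (st j) => s eta /= eta0.
  case: (F _) => t [m rho] /= /(_ eta0)[rho0 _ _ _].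
  by rewrite lt_min rho0 divr_gt0.
exists (fun j => (F (j, st j)).1), (fun j => (st j).1), (fun j => (F (j, st j)).2.1),
  (fun j => (st j).2).
have stP j := FP (j, st j).
split=> [//|j|j x||].
- by rewrite /= ge_min lexx orbT.
- move: (stP j) (st0 j); case: (st j) => s eta /=.
  by case: (F _) => t [m rho] /= h /h[_ _ + _]; apply.
- by [].
split=> [//|j|j K].
  move: (stP j) (st0 j); case: (st j) => s eta /=.
  by case: (F _) => t [m rho] /= h /h[].
move: (stP j) (st0 j); rewrite /=; case: (st j) => s eta /=.
case: (F _) => t [m rho] /= h /h[_ _ _ +] tK Ks; apply=> // x /Ks[xs|xt|xr].
- exact: Or31.
- exact: Or32.
- by apply: Or33; apply: (le_trans xr); rewrite ge_min lexx.
Qed.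

(** [K] is 0 with all the points of all stages. For stage j, earlier points are in [s j], its own in
    [t j], and later ones have norm at most [eta j.+1]. *)
Lemma exists_compact_set : exists K : set Y, [/\ K !=set0, compact K &
  forall j, exists2 m, (j <= m)%N &
    (j%:R%:E <= kolmogorov_width m K / absolute_width m K)%E].
Proof.
have [t [s [m [eta [eta0 eta2 t_le s_cat [s0 jm mP]]]]]] := exists_stage_sequence.
have eta_le i j : (i <= j)%N -> eta j <= eta i.
  move=> ij; rewrite -(subnK ij); elim: (j - i)%N => [|l IH]; first by rewrite add0n.
  rewrite addSn; apply: le_trans IH; apply: (le_trans (eta2 _)).
  by have := eta0 (l + i)%N; lra.
have eta_exp j : eta j <= eta 0%N / 2 ^+ j.
  elim: j => [|j IH]; first by rewrite expr0 divr1.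
  apply: (le_trans (eta2 j)); rewrite exprSr invfM mulrA.
  by rewrite ler_pM2r ?invr_gt0.
have s_sub i j x : (i <= j)%N -> x \in s i -> x \in s j.
  move=> ij; rewrite -(subnK ij); elim: (j - i)%N => [|l IH xi]; first by rewrite add0n.
  by rewrite addSn s_cat mem_cat IH.
have s_tail i j x : x \in s i -> x \in s j \/ `|x| <= eta j.
  have [ij|ji] := leqP i j; first by move=> /(s_sub _ _ _ ij); left.
  move: (ltnW ji) => /subnK <-; elim: (i - j)%N => [|l IH]; first by left.
  rewrite addSn s_cat mem_cat => /orP[/IH//|/t_le xl]; right.
  by apply: (le_trans xl); apply: eta_le; exact: leq_addl.
pose K : set Y := [set x | x = 0 \/ exists j, x \in s j].
exists K; split; first by exists 0; left.
  apply: compact_finite_away_from_0; first by left.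
  move=> e e0.
  have [j je] : exists j, eta j < e.
    exists (Num.truncn (eta 0%N / e)).+1; apply: (le_lt_trans (eta_exp _)).
    rewrite ltr_pdivrMr ?exprn_gt0// mulrC -ltr_pdivrMr//.
    apply: (lt_le_trans (truncnS_gt _)).
    by rewrite -natrX ler_nat ltnW// ltn_expl.
  apply: (sub_finite_set _ (finite_seq (s j))) => x [[->|[i /(s_tail i j)[//|xj]]] /=].
    by rewrite normr0 leNgt e0.
  by move=> /le_trans/(_ xj); rewrite leNgt je.
move=> j; exists (m j) => //; apply: mP => [x xt|x].
  by right; exists j.+1; rewrite s_cat mem_cat xt orbT.
move=> [->|[i /(s_tail i j.+1)]]; first by apply: Or33; rewrite normr0 ltW.
by rewrite s_cat mem_cat => -[/orP[]|] h; [exact: Or31|exact: Or32|exact: Or33].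
Qed.

End Construction.

(* K is nonempty because the widths of the empty set are -oo and
   -oo / -oo = +oo in \bar R. *)
Theorem proposition6p2 (R : realType) (Y : completeNormedModType R)
    (gamma sigma : R) (gamma_gt0 : 0 < gamma)
    (sigma_ge0 : 0 <= sigma) (sigma_lt : sigma < 1 / 2)
    (hY : infinite_set [set n : nat | (0 < n)%N /\
      exists (A : {linear l2 R n -> Y}) (B : {linear Y -> l2 R n}),
        [/\ (opnorm A < +oo)%E, (opnorm B < +oo)%E,
            forall x : l2 R n, B (A x) = x &
            (opnorm A * opnorm B <= (gamma * n%:R `^ sigma)%:E)%E]]) :
  exists K : set Y, [/\ K !=set0, compact K &
    limn_esup (fun n : nat =>
      (kolmogorov_width n K / absolute_width n K)%E) = (+oo)%E].
Proof.
have [K [K0 Kc KP]] := exists_compact_set gamma_gt0 sigma_ge0 sigma_lt hY.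
exists K; split=> //; apply: eq_infty => r.
apply: le_ereal_inf_tmp => _ [V [N _ NV] <-].
(* Past [N] the index lies in the given tail, and past [r] the ratio exceeds it. *)
pose j := maxn N (Num.truncn r).+1.
have [m jm mP] := KP j.
apply: le_ereal_sup_tmp; exists (kolmogorov_width m K / absolute_width m K)%E.
  by exists m => //; apply: NV; exact: leq_trans (leq_maxl _ _) jm.
apply: le_trans mP; rewrite lee_fin; apply/ltW/(lt_le_trans (truncnS_gt r)).
by rewrite ler_nat leq_maxr.
Qed.
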